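(* Let $v=(v_1,v_2)\in\mathbb{R}_{>0}^2$. If $M$ is a finitely presented interval module over $\mathbf{R}^2=\mathbb{R}_{\ge0}^2$ (the bivariate case), then $\dim_v(M)$ can be computed in $O(n)$ time, where $n:=\beta_0(M)$.
   Context: Let $\mathbb{K}$ be a field and $\mathbf{R}^2=\mathbb{R}_{\ge 0}^2$ with the componentwise partial order. A persistence module is a functor from the poset $\mathbf{R}^2$ to $\mathbb{K}$-vector spaces, equivalently an $\mathbf{R}^2$-graded module over the monoid ring $\mathbb{K}[\mathbf{R}^2]$ of the monoid $(\mathbb{R}_{\ge 0}^2,+)$; finitely presented refers to the latter. For $v\in\mathbf{R}^2$, $v\ast m$ denotes the product of $m\in M$ with the monoid element $v$, and $v\ast M=\{v\ast m\mid m\in M\}$. A subset of $\mathbf{R}^2$ is an interval if (a) $g\le f\le h$ with $g,h$ in the subset implies $f$ in the subset, and (b) any two elements $g,h$ of it are connected by a zigzag $g\le g_1\ge g_2\le\cdots\ge g_{2m}\le h$ inside the subset. An interval module is a persistence module with value $\mathbb{K}$ on an interval, value $0$ elsewhere, and identity maps between the copies of $\mathbb{K}$. $\beta_0(M)$ is the minimal number of homogeneous generators of $M$. Shift-dimension: all elements of graded modules are taken homogeneous. Elements $m_1,\dots,m_k\in M$ $v$-generate $M$ if $v\ast(M/\langle m_1,\dots,m_k\rangle)=0$. A $v$-basis is a set of $v$-generators of smallest possible cardinality $k$, and $\dim_v(M):=k$ is the shift-dimension. Cost model: $M$ is given by the degrees of its minimal generators and of the elements quotiented out, each as a finite sorted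 array; additions of real numbers and determining a minimum of a finite array of sorted data (including the query whether $v\ast\mathfrak{g}=0$ for a given minimal generator $\mathfrak{g}$) count as $O(1)$ operations. *)

(* Defs.v *)
From HB Require Import structures.
From mathcomp Require Import all_boot all_order all_algebra.
From mathcomp Require Import generic_quotient ring_quotient.
From mathcomp Require Import all_classical all_reals all_analysis.

Set Implicit Arguments.
Unset Strict Implicit.
Unset Printing Implicit Defensive.

Import Order.TTheory GRing.Theory Num.Theory numFieldNormedType.Exports.
Local Open Scope classical_set_scope.
Local Open Scope ring_scope.

(** * The poset and monoid [R_{>=0}^2] *)

Definition grade (R : realType) := ({nonneg R} *p {nonneg R})%type.

Definition grade0 (R : realType) : grade R := (0%:nng, 0%:nng).

Definition gadd (R : realType) (g h : grade R) : grade R :=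
  ((g.1%:num + h.1%:num)%:nng, (g.2%:num + h.2%:num)%:nng).

Lemma le_gadd (R : realType) (g v : grade R) : (g <= gadd g v)%O.
Proof.
by apply/andP; split; rewrite -num_le /= lerDl.
Qed.

(** * Persistence modules *)

Record pmod (R : realType) (K : fieldType) := PMod {
  pm_obj :> grade R -> lmodType K;
  pm_map : forall g h : grade R, (g <= h)%O -> {linear pm_obj g -> pm_obj h};
  pm_map_id : forall (g : grade R) (gg : (g <= g)%O) (x : pm_obj g),
    pm_map gg x = x;
  pm_map_comp : forall (f g h : grade R)
      (fg : (f <= g)%O) (gh : (g <= h)%O) (fh : (f <= h)%O) (x : pm_obj f),
    pm_map gh (pm_map fg x) = pm_map fh x
}.

(* [vshift v m] is the product of the homogeneous element [m] with the monoid
   element [v]; [shift_zero v M] says that [v * M = 0]. *)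
Definition vshift (R : realType) (K : fieldType) (M : pmod R K) (v g : grade R)
  (m : M g) : M (gadd g v) := pm_map M (le_gadd g v) m.

Definition shift_zero (R : realType) (K : fieldType) (v : grade R)
  (M : pmod R K) : Prop := forall (g : grade R) (m : M g), vshift v m = 0.

Record pmor (R : realType) (K : fieldType) (M N : pmod R K) := PMor {
  pmor_fun :> forall g : grade R, {linear M g -> N g};
  pmor_nat : forall (g h : grade R) (gh : (g <= h)%O) (x : M g),
    pmor_fun h (pm_map M gh x) = pm_map N gh (pmor_fun g x)
}.

Definition pm_iso (R : realType) (K : fieldType) (M N : pmod R K) : Prop :=
  exists f : pmor M N, forall g : grade R, bijective (f g).

(* Homogeneous elements, with their degree as first component. *)
Definition helem (R : realType) (K : fieldType) (M : pmod R K) :=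
  {g : grade R & M g}.

(** * Submodules and quotients *)

Record submod (R : realType) (K : fieldType) (M : pmod R K) := SubMod {
  sub_at :> forall g : grade R, {pred M g};
  sub_closed : forall g : grade R, submod_closed (@sub_at g);
  sub_stable : forall (g h : grade R) (gh : (g <= h)%O) (x : M g),
    x \in @sub_at g -> pm_map M gh x \in @sub_at h
}.
Arguments sub_at {R K M} s g : rename.
Arguments sub_closed {R K M} s g : rename.

Section Span.
Variables (R : realType) (K : fieldType) (M : pmod R K) (ms : seq (helem M)).

Definition pspan_at (g : grade R) : {pred M g} := [pred x : M g |
  `[< forall N : submod M,
        all (fun m : helem M => tagged m \in N (tag m)) ms -> x \in N g >]].

Arguments pspan_at : clear implicits.

Lemma pspan_closed g : submod_closed (pspan_at g).
Proof.
split; first by apply/asboolP => N _; case: (sub_closed N g).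
move=> a x y /asboolP xS /asboolP yS; apply/asboolP => N Nms.
by case: (sub_closed N g) => _; apply; [apply: xS|apply: yS].
Qed.

Lemma pspan_stable (g h : grade R) (gh : (g <= h)%O) (x : M g) :
  x \in pspan_at g -> pm_map M gh x \in pspan_at h.
Proof.
by move=> /asboolP xS; apply/asboolP => N Nms; apply/sub_stable/xS.
Qed.

(* The submodule generated by the homogeneous elements [ms]. *)
Definition pspan : submod M := SubMod pspan_closed pspan_stable.

End Span.

Section QuotientSpace.
Variables (K : fieldType) (V : lmodType K) (S : {pred V}).
Hypothesis hS : submod_closed S.

Definition lquot_zmod : zmodClosed V :=
  HB.pack S (GRing.isZmodClosed.Build V S (GRing.submod_closedB hS)).

Definition lquot := Quotient.quot lquot_zmod.

HB.instance Definition _ := GRing.Zmodule.on lquot.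

Definition lquot_pi (x : V) : lquot := (\pi_lquot x)%qT.

Lemma lquot_piP (x y : V) : lquot_pi x = lquot_pi y <-> x - y \in S.
Proof.
by split=> [/eqP|H]; [|apply/eqP]; rewrite -(Quotient.idealrBE lquot_zmod).
Qed.

Lemma lquot_piK (q : lquot) : lquot_pi (repr q) = q.
Proof. exact: reprK. Qed.

Lemma lquot_piD : {morph lquot_pi : x y / x + y}.
Proof. by move=> x y; rewrite /lquot_pi !piE. Qed.

Lemma lquot_SZ a x : x \in S -> a *: x \in S.
Proof. by move=> xS; have [S0 SL] := hS; rewrite -[_ *: _]addr0 SL. Qed.

Definition lquot_scale (a : K) (q : lquot) : lquot := lquot_pi (a *: repr q).

Lemma lquot_piZ a x : lquot_scale a (lquot_pi x) = lquot_pi (a *: x).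
Proof.
apply/lquot_piP; rewrite -scalerBr; apply/lquot_SZ/lquot_piP.
exact: lquot_piK.
Qed.

Lemma lquot_scaleA a b q :
  lquot_scale a (lquot_scale b q) = lquot_scale (a * b) q.
Proof. by rewrite -[q]lquot_piK !lquot_piZ scalerA. Qed.

Lemma lquot_scale1 : left_id 1 lquot_scale.
Proof. by move=> q; rewrite -[q]lquot_piK lquot_piZ scale1r. Qed.

Lemma lquot_scaleDr : right_distributive lquot_scale +%R.
Proof.
move=> a p q; rewrite -[p]lquot_piK -[q]lquot_piK.
by rewrite -lquot_piD !lquot_piZ -lquot_piD scalerDr.
Qed.

Lemma lquot_scaleDl q : {morph lquot_scale^~ q : a b / a + b}.
Proof.
by move=> a b; rewrite -[q]lquot_piK !lquot_piZ -lquot_piD scalerDl.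
Qed.

HB.instance Definition _ := GRing.Zmodule_isLmodule.Build K lquot
  lquot_scaleA lquot_scale1 lquot_scaleDr lquot_scaleDl.

Lemma lquot_pi_linear : linear lquot_pi.
Proof. by move=> a x y; rewrite lquot_piD -lquot_piZ. Qed.

HB.instance Definition _ := GRing.isLinear.Build K V lquot *:%R lquot_pi
  lquot_pi_linear.

Lemma lquot_pi0 (x : V) : lquot_pi x = 0 <-> x \in S.
Proof. by rewrite -(linear0 lquot_pi) lquot_piP subr0. Qed.

End QuotientSpace.

Section QuotientModule.
Variables (R : realType) (K : fieldType) (M : pmod R K) (N : submod M).

Definition pquot_obj (g : grade R) : lmodType K := lquot (sub_closed N g).

Section Map.
Variables (g h : grade R) (gh : (g <= h)%O).

Definition pquot_map (q : pquot_obj g) : pquot_obj h :=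
  lquot_pi (sub_closed N h) (pm_map M gh (repr q)).

Lemma pquot_map_pi x :
  pquot_map (lquot_pi (sub_closed N g) x) =
  lquot_pi (sub_closed N h) (pm_map M gh x).
Proof.
apply/lquot_piP; rewrite -linearB; apply/sub_stable.
by apply/(lquot_piP (sub_closed N g)); exact: lquot_piK.
Qed.

Lemma pquot_map_linear : linear pquot_map.
Proof.
move=> a p q; rewrite -[p]lquot_piK -[q]lquot_piK.
by rewrite -linearP !pquot_map_pi -linearP -linearP.
Qed.

HB.instance Definition _ :=
  GRing.isLinear.Build K (pquot_obj g) (pquot_obj h) *:%R pquot_map
    pquot_map_linear.

End Map.

Lemma pquot_map_id g (gg : (g <= g)%O) (q : pquot_obj g) :
  pquot_map gg q = q.
Proof. by rewrite -[q]lquot_piK pquot_map_pi pm_map_id. Qed.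

Lemma pquot_map_comp (f g h : grade R) (fg : (f <= g)%O) (gh : (g <= h)%O)
    (fh : (f <= h)%O) (q : pquot_obj f) :
  pquot_map gh (pquot_map fg q) = pquot_map fh q.
Proof. by rewrite -[q]lquot_piK !pquot_map_pi (pm_map_comp _ _ fh). Qed.

Definition pquot : pmod R K :=
  @PMod R K pquot_obj (fun g h gh => pquot_map gh) pquot_map_id pquot_map_comp.

End QuotientModule.

(** * Generators, the zeroth Betti number and the shift-dimension *)

Definition generates (R : realType) (K : fieldType) (M : pmod R K)
  (ms : seq (helem M)) : Prop := forall (g : grade R) (x : M g), x \in pspan ms g.

Definition min_generators (R : realType) (K : fieldType) (M : pmod R K)
    (ms : seq (helem M)) : Prop :=
  generates ms /\
  forall ms' : seq (helem M), generates ms' -> (size ms <= size ms')%N.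

Definition is_beta0 (R : realType) (K : fieldType) (M : pmod R K) (n : nat) :
  Prop := exists ms : seq (helem M), min_generators ms /\ size ms = n.

Definition v_generates (R : realType) (K : fieldType) (M : pmod R K)
  (v : grade R) (ms : seq (helem M)) : Prop := shift_zero v (pquot (pspan ms)).

Definition v_basis (R : realType) (K : fieldType) (M : pmod R K)
    (v : grade R) (ms : seq (helem M)) : Prop :=
  v_generates v ms /\
  forall ms' : seq (helem M), v_generates v ms' -> (size ms <= size ms')%N.

Definition is_shift_dim (R : realType) (K : fieldType) (M : pmod R K)
  (v : grade R) (k : nat) : Prop :=
  exists ms : seq (helem M), v_basis v ms /\ size ms = k.

(** * Intervals and (sums of) interval modules *)

Definition gconvex (R : realType) (I : set (grade R)) : Prop :=
  forall g f h : grade R, (g <= f)%O -> (f <= h)%O -> I g -> I h -> I f.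

(* [z 0 <= z 1 >= z 2 <= ... >= z (2m) <= z (2m+1)] inside [I]. *)
Definition gconnected (R : realType) (I : set (grade R)) : Prop :=
  forall g h : grade R, I g -> I h ->
  exists (m : nat) (z : nat -> grade R),
    [/\ z 0%N = g, z m.*2.+1 = h,
        forall i, (i <= m.*2.+1)%N -> I (z i),
        forall i, (i <= m)%N -> (z i.*2 <= z i.*2.+1)%O &
        forall i, (i < m)%N -> (z i.+1.*2 <= z i.*2.+1)%O].

Definition is_interval (R : realType) (I : set (grade R)) : Prop :=
  gconvex I /\ gconnected I.

(* The direct sum over [j : J] of the modules with value [K] on [S j], value [0]
   elsewhere and identity maps between the copies of [K]: the component of
   degree [g] consists of the [K]-valued functions on [{j | S j g}]. *)
Section IntervalSum.
Variables (R : realType) (K : fieldType).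
Variables (J : finType) (S : J -> set (grade R)).
Hypothesis cS : forall j, gconvex (S j).

Definition ivl_obj (g : grade R) : lmodType K :=
  {ffun {j : J | `[< S j g >]} -> K^o}.

Section Map.
Variables (g h : grade R).

Definition ivl_map (f : ivl_obj g) : ivl_obj h :=
  [ffun j : {j : J | `[< S j h >]} =>
     (if insub (val j) is Some i then f i else 0) : K^o].

Lemma ivl_map_linear : linear ivl_map.
Proof.
move=> a f f'; apply/ffunP => j; rewrite !ffunE.
by case: insubP => [i _ _|_]; rewrite ?ffunE// scaler0 addr0.
Qed.

HB.instance Definition _ :=
  GRing.isLinear.Build K (ivl_obj g) (ivl_obj h) *:%R ivl_map ivl_map_linear.

End Map.

Lemma ivl_map_id g (gg : (g <= g)%O) (f : ivl_obj g) : ivl_map g f = f.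
Proof.
apply/ffunP => j; rewrite ffunE; case: insubP => [i _ ij|].
  by congr (f _); apply: val_inj.
by rewrite (valP j).
Qed.

Lemma ivl_map_comp (f g h : grade R) (fg : (f <= g)%O) (gh : (g <= h)%O)
    (fh : (f <= h)%O) (x : ivl_obj f) :
  ivl_map h (ivl_map g x) = ivl_map h x.
Proof.
apply/ffunP => j; rewrite !ffunE; case: insubP => [i _ ij|jg].
  by rewrite ffunE ij.
case: insubP => // i _ ij; case/negP: jg.
have Sf : S (val j) f by rewrite -ij; exact/asboolP/(valP i).
have Sh : S (val j) h by exact/asboolP/(valP j).
exact/asboolP/(cS fg gh Sf Sh).
Qed.

Definition ivl_sum : pmod R K :=
  @PMod R K ivl_obj (fun g h _ => ivl_map h) ivl_map_id ivl_map_comp.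

End IntervalSum.

Definition interval_mod (R : realType) (K : fieldType) (I : set (grade R))
    (cI : gconvex I) : pmod R K :=
  ivl_sum K (fun _ : unit => cI).

Definition is_interval_module (R : realType) (K : fieldType) (M : pmod R K) :
  Prop := exists (I : set (grade R)) (hI : is_interval I),
    pm_iso M (interval_mod K hI.1).

(** * Free modules and finite presentations *)

Lemma up_convex (R : realType) (s : seq (grade R)) :
  gconvex [set g : grade R | has (fun a => (a <= g)%O) s].
Proof.
move=> g f h gf _ /hasP[a sa ag] _.
by apply/hasP; exists a => //; apply: le_trans gf.
Qed.

Lemma up1_convex (R : realType) (a : grade R) :
  gconvex [set g : grade R | (a <= g)%O].
Proof. by move=> g f h gf _ ag _; apply: le_trans gf. Qed.

(* The free module with one generator in each degree [a i]. *)
Definition pfree (R : realType) (K : fieldType) (n : nat)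
    (a : 'I_n -> grade R) : pmod R K :=
  ivl_sum K (fun i => @up1_convex R (a i)).

Definition fin_presented (R : realType) (K : fieldType) (M : pmod R K) : Prop :=
  exists (n : nat) (a : 'I_n -> grade R) (p : pmor (pfree K a) M),
    (forall (g : grade R) (y : M g), exists x, p g x = y) /\
    exists rs : seq (helem (pfree K a)),
      forall (g : grade R) (x : pfree K a g), p g x = 0 <-> x \in pspan rs g.

(** * How the input is given *)

(* [up_mod K gens] is the submodule of [K[R_{>=0}^2]] generated by the monomials
   of degrees [gens]; [up_mono K gens b] is its monomial of degree [b] (provided
   some element of [gens] is below [b]). *)
Definition up_mod (R : realType) (K : fieldType) (gens : seq (grade R)) :
  pmod R K := interval_mod K (@up_convex R gens).

Definition up_mono (R : realType) (K : fieldType) (gens : seq (grade R))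
    (b : grade R) : helem (up_mod K gens) :=
  Tagged (fun g => up_mod K gens g)
    ([ffun=> 1 : K^o] : up_mod K gens b).

Definition lex_sorted (R : realType) (s : seq (grade R)) : bool :=
  sorted <=%O (s : seq ({nonneg R} *l {nonneg R})).

(* [gens] lists the degrees of the minimal generators of [M], [rels] the degrees
   of the elements quotiented out of the module they generate; [rels] need not
   be irredundant. *)
Definition given_by (R : realType) (K : fieldType) (M : pmod R K)
    (gens rels : seq (grade R)) : Prop :=
  [/\ lex_sorted gens /\ lex_sorted rels,
      exists2 ms : seq (helem M), min_generators ms & map tag ms = gens,
      all (fun b => has (fun a => (a <= b)%O) gens) rels &
      pm_iso M (pquot (pspan (map (up_mono K gens) rels)))].

(** * The cost model: a real random access machine with unit cost *)

Inductive array := Gens | Rels.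

Inductive coord := CX | CY.

(* [i j] are index registers, [r s t] are real registers, [l] is a program
   address.  Array indices start at [0]. *)
Inductive instr :=
| IZero of nat                                (* i := 0 *)
| ISucc of nat                                (* i := i + 1 *)
| ICopy of nat & nat                          (* i := j *)
| ILength of nat & array                      (* i := length of the array *)
| IJumpLt of nat & nat & nat                  (* if i < j goto l *)
| RShift of nat & coord                       (* r := coordinate of v *)
| RLoad of nat & array & coord & nat          (* r := coordinate of array[i] *)
| RMin of nat & array & coord & nat & nat     (* r := minimum of the coordinate
                                                 over array[i], ..., array[j-1] *)
| RAdd of nat & nat & nat                     (* r := s + t *)
| RJumpLe of nat & nat & nat                  (* if r <= s goto l *)
| JumpZero of nat & nat.                      (* if v * gens[i] = 0 goto l *)

Definition program := seq instr.

Record input (R : realType) := Input {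
  in_v : grade R;
  in_gens : seq (grade R);
  in_rels : seq (grade R)
}.

Record state (R : realType) := State {
  pc : nat;
  ireg : nat -> nat;
  rreg : nat -> R
}.

Section Semantics.
Variables (R : realType) (inp : input R).

Definition arr (a : array) : seq (grade R) :=
  match a with Gens => in_gens inp | Rels => in_rels inp end.

Definition crd (c : coord) (g : grade R) : R :=
  match c with CX => g.1%:num | CY => g.2%:num end.

Definition entry (a : array) (i : nat) : grade R := nth (grade0 R) (arr a) i.

Definition slice_min (a : array) (c : coord) (i j : nat) : R :=
  if map (crd c) (drop i (take j (arr a))) is x :: s
  then foldr Num.min x s else 0.

(* The [i]-th generator is shifted to [0] by [v] iff its shifted degree is above
   the degree of some element quotiented out. *)
Definition zero_query (i : nat) : bool :=
  has (fun b => (b <= gadd (entry Gens i) (in_v inp))%O) (in_rels inp).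

Definition upd (T : Type) (f : nat -> T) (i : nat) (x : T) : nat -> T :=
  fun k => if k == i then x else f k.

Definition exec (c : instr) (s : state R) : state R :=
  let: State k f h := s in
  match c with
  | IZero i => State k.+1 (upd f i 0%N) h
  | ISucc i => State k.+1 (upd f i (f i).+1) h
  | ICopy i j => State k.+1 (upd f i (f j)) h
  | ILength i a => State k.+1 (upd f i (size (arr a))) h
  | IJumpLt i j l => State (if (f i < f j)%N then l else k.+1) f h
  | RShift r c => State k.+1 f (upd h r (crd c (in_v inp)))
  | RLoad r a c i => State k.+1 f (upd h r (crd c (entry a (f i))))
  | RMin r a c i j => State k.+1 f (upd h r (slice_min a c (f i) (f j)))
  | RAdd r s t => State k.+1 f (upd h r (h s + h t))
  | RJumpLe r s l => State (if h r <= h s then l else k.+1) f h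
  | JumpZero i l => State (if zero_query (f i) then l else k.+1) f h
  end.

(* The machine halts when the program counter leaves the program. *)
Definition halted (p : program) (s : state R) : bool := (size p <= pc s)%N.

Definition step (p : program) (s : state R) : state R :=
  if halted p s then s else exec (nth (IZero 0) p (pc s)) s.

Definition init : state R := State 0 (fun=> 0%N) (fun=> 0).

(* Within [t] unit-cost steps, [p] halts with [d] in index register [0]. *)
Definition computes_within (p : program) (t d : nat) : Prop :=
  let s := iter t (step p) init in halted p s /\ ireg s 0 = d.

End Semantics.

(* Main.v *)
Require Import Defs.
From mathcomp Require Import all_boot all_order all_algebra.
From mathcomp Require Import all_classical all_reals all_analysis zify.

Set Implicit Arguments.
Unset Strict Implicit.
Unset Printing Implicit Defensive.

Import Order.TTheory GRing.Theory Num.Theory numFieldNormedType.Exports.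
Local Open Scope classical_set_scope.
Local Open Scope ring_scope.

(** The module [M] is, up to isomorphism, one-dimensional on the region [I] of
    degrees above a generator and above no relation, zero elsewhere, and all its
    maps inside [I] are nonzero.  Over such a thin module, the span of
    homogeneous elements only depends on the degrees of the nonzero ones: it is
    everything above one of these degrees and zero elsewhere
    ([thin_mem_pspan]).  Hence the shift-dimension is a covering number
    ([shift_dim_covers]): call a generator degree [a] alive if [a + v] still
    lies in [I]; one looks for the least number of points of [I] such that every
    alive [a + v] is above one of them.

    By minimality no generator degree is below another one, so in the
    lexicographic order they form a staircase that goes right and strictly down
    ([min_generators_stair]).  Scan it from left to right.  The first alive [a]
    not yet served needs a new point below [a + v], and the best choice is the
    last, hence lowest, generator whose abscissa is at most that of [a + v]: it
    serves the longest run of generators to the right of [a].  No point of [I]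
    can be below both [a + v] and [b + v] for two generators [a], [b] at which
    the scan added a point, since a generator below that point would be lower
    than the point chosen for [a]; therefore the greedy choice is optimal
    ([greedy_lower_bound], [greedy_covers]).

    The abscissa of [a + v] grows along the scan, so a second index that only
    moves to the right finds all the chosen points.  The two indices together
    make at most [2 n] moves, each at a bounded cost ([outer_loop]). *)

(** * Thin modules *)

Section Thin.
Variables (R : realType) (K : fieldType).

(** As [e g] vanishes exactly outside [I], the first clause also says that [M]
    is zero there. *)
Definition thin_basis (M : pmod R K) (I : pred (grade R))
    (e : forall g, M g) : Prop :=
  [/\ forall g (x : M g), exists c : K, x = c *: e g,
      forall g, (e g != 0) = I g &
      forall g h (gh : (g <= h)%O), I g -> I h -> pm_map M gh (e g) = e h].

Definition thin (M : pmod R K) (I : pred (grade R)) : Prop :=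
  exists e, @thin_basis M I e.

(** The image of [m] in degree [g] exists and, if [g] lies in the support of a
    thin module, is nonzero. *)
Definition reaches (M : pmod R K) (g : grade R) : pred (helem M) :=
  fun m => (tagged m != 0) && (tag m <= g)%O.

(** A nonzero multiple of a basis vector spans all that lies above it; conversely,
    the degrees above a nonzero element of [ms] carry a submodule which is zero
    in all other degrees. *)
Lemma thin_mem_pspan (M : pmod R K) I : thin M I ->
  forall ms g (x : M g),
  (x \in pspan ms g) = (x == 0) || has (reaches g) ms.
Proof.
move=> [e [eM eI eE]] ms g x; apply/idP/idP; last first.
  move=> xms; apply/asboolP => N Nms; have [N0 NL] := sub_closed N g.
  have [->//|x0] := eqVneq x 0; move: xms; rewrite (negbTE x0) /=.
  case/hasP => -[a y] ams /andP[/= y0 ag].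
  have Na : y \in N a by move/allP/(_ _ ams): Nms.
  have [c yE] := eM a y; have [c' xE] := eM g x.
  have [c0 Ia] : c != 0 /\ I a.
    by apply/andP; rewrite -eI -negb_or -scaler_eq0 -yE.
  have Ig : I g by move: x0; rewrite xE scaler_eq0 negb_or eI => /andP[].
  have <- : (c' / c) *: pm_map M ag y + 0 = x.
    by rewrite addr0 yE linearZ /= eE// scalerA divfK.
  by apply: NL => //; exact: sub_stable.
(* The full module above the degrees of the nonzero elements of ms. *)
pose N_at h : {pred M h} := [pred z | (z == 0) || has (reaches h) ms].
have Nc h : submod_closed (N_at h).
  split; rewrite ?inE ?eqxx//= => a y z; rewrite !inE.
  case: has; rewrite ?orbT// !orbF => /eqP-> /eqP->.
  by rewrite scaler0 addr0.
have Ns h h' (hh : (h <= h')%O) z : z \in N_at h -> pm_map M hh z \in N_at h'.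
  rewrite !inE => /orP[/eqP->|]; first by rewrite linear0 eqxx.
  move=> hms; apply/orP; right; apply: sub_has hms => m /andP[m0 mh].
  by rewrite /reaches m0 (le_trans mh).
move=> /asboolP /(_ (SubMod Nc Ns)) /=; apply.
apply/allP => m mms; rewrite inE; have [//|m0 /=] := eqVneq.
by apply/hasP; exists m => //; rewrite /reaches m0 /=.
Qed.

Lemma thin_iso (M N : pmod R K) I : pm_iso M N -> thin N I -> thin M I.
Proof.
move=> [f fb] [e [eM eI eE]].
have ex g : exists x, f g x == e g.
  by have [k _ fk] := fb g; exists (k (e g)); rewrite fk.
have fi g : injective (f g) by exact/bij_inj/fb.
pose e' g := xchoose (ex g); have fe' g : f g (e' g) = e g.
  exact/eqP/(xchooseP (ex g)).
exists e'; split.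
- move=> g x; have [c fx] := eM g (f g x); exists c; apply: fi.
  by rewrite fx linearZ /= fe'.
- by move=> g; rewrite -eI -fe' -(inj_eq (@fi g)) linear0.
- move=> g h gh Ig Ih; apply: fi; rewrite pmor_nat !fe'; exact: eE.
Qed.

Lemma thin_pquot (M : pmod R K) I (ms : seq (helem M)) : thin M I ->
  thin (pquot (pspan ms)) (fun g => I g && ~~ has (reaches g) ms).
Proof.
move=> Mthin; have [e [eM eI eE]] := Mthin.
exists (fun g => lquot_pi (sub_closed (pspan ms) g) (e g)); split.
- move=> g q; rewrite -[q]lquot_piK; have [c ->] := eM g (repr q).
  by exists c; rewrite linearZ.
- move=> g; rewrite -eI -negb_or -(thin_mem_pspan Mthin); congr negb.
  by apply/eqP/idP => [/lquot_pi0|?]; [|apply/lquot_pi0].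
- move=> g h gh /andP[Ig _] /andP[Ih _].
  by rewrite /= pquot_map_pi eE.
Qed.

Lemma thin_interval_mod (I : pred (grade R)) (cI : gconvex [set g | I g]) :
  thin (interval_mod K cI) I.
Proof.
exists (fun g => [ffun=> 1 : K^o]); split.
- move=> g x; case: (boolP (I g)) => Ig.
    have j : {j : unit | `[< [set g | I g] g >]} by exists tt; apply/asboolP.
    exists (x j); apply/ffunP => i; rewrite !ffunE /= [_ *: _]mulr1.
    by congr (x _); apply: val_inj; case: (val i) (val j) => -[].
  exists 0; apply/ffunP => i; exfalso.
  by move/negP: Ig; apply; have /asboolP := valP i.
- move=> g; apply/idP/idP; last first.
    move=> Ig; have j : {j : unit | `[< [set g | I g] g >]}.
      by exists tt; apply/asboolP.
    apply/eqP => /ffunP/(_ j); rewrite !ffunE => /eqP.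
    by rewrite oner_eq0.
  apply: contraNT => Ig; apply/eqP/ffunP => i; exfalso.
  by move/negP: Ig; apply; have /asboolP := valP i.
- move=> g h gh Ig Ih; apply/ffunP => i; rewrite !ffunE.
  case: insubP => [j _ _|]; first by rewrite ffunE.
  by move/asboolP.
Qed.


Definition region (gens rels : seq (grade R)) : pred (grade R) :=
  fun g => has (fun a => (a <= g)%O) gens && ~~ has (fun b => (b <= g)%O) rels.

(** The monomials that are quotiented out lie in the upset of [gens] and hence are
    nonzero, so that their span is supported on the upset of their degrees. *)
Lemma given_by_thin (M : pmod R K) gens rels :
  given_by M gens rels -> thin M (region gens rels).
Proof.
case=> _ _ relsP /thin_iso; apply.
pose up : pred (grade R) := fun g => has (fun a => (a <= g)%O) gens.
have Uthin : thin (up_mod K gens) up := thin_interval_mod (@up_convex R gens).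
suff -> : region gens rels =
    fun g => up g && ~~ has (reaches g) (map (up_mono K gens) rels).
  exact: thin_pquot.
apply/funext => g; rewrite /region has_map; congr (_ && ~~ _).
apply: eq_in_has => b brels; rewrite /reaches /=.
suff -> : ([ffun=> 1] : up_mod K gens b) != 0 by [].
have j : {j : unit | `[< [set g | up g] b >]}.
  by exists tt; apply/asboolP; exact: (allP relsP).
by apply/eqP => /ffunP/(_ j); rewrite !ffunE => /eqP; rewrite oner_eq0.
Qed.

Lemma thin_generatesP (M : pmod R K) I (ms : seq (helem M)) : thin M I ->
  generates ms <-> forall g, I g -> has (reaches g) ms.
Proof.
move=> Mthin; have [e [eM eI _]] := Mthin; split=> [gen g|gen g x].
  rewrite -eI => e0; have := gen g (e g).
  by rewrite (thin_mem_pspan Mthin) (negbTE e0).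
rewrite (thin_mem_pspan Mthin); have [//|x0 /=] := eqVneq; apply: gen.
by move: x0; have [c ->] := eM g x; rewrite scaler_eq0 negb_or eI => /andP[].
Qed.

Lemma thin_v_generatesP (M : pmod R K) I v (ms : seq (helem M)) : thin M I ->
  v_generates v ms <->
  forall g, I g -> I (gadd g v) -> has (reaches (gadd g v)) ms.
Proof.
move=> Mthin; have [e [eM eI eE]] := Mthin; split=> gen g.
  move=> Ig Igv; have := gen g (lquot_pi (sub_closed (pspan ms) g) (e g)).
  rewrite /vshift /= pquot_map_pi => /lquot_pi0.
  by rewrite eE// (thin_mem_pspan Mthin) (negbTE (_ : e _ != 0)) ?eI.
move=> q; rewrite -[q]lquot_piK /vshift /= pquot_map_pi; apply/lquot_pi0.
rewrite (thin_mem_pspan Mthin); have [//|x0 /=] := eqVneq.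
have [c xE] := eM g (repr q); apply: gen; rewrite -eI.
  by apply: contraNneq x0 => e0; rewrite xE e0 scaler0 linear0.
apply: contraNneq x0 => e0.
by have [c' ->] := eM _ (pm_map M (le_gadd g v) (repr q)); rewrite e0 scaler0.
Qed.

End Thin.

(** * Shift-dimension as a covering number *)

Section ShiftDim.
Variables (R : realType) (v : grade R) (gens rels : seq (grade R)).

(** The generator of degree [a] is not shifted to zero by [v]. *)
Definition alive (a : grade R) : bool :=
  ~~ has (fun b => (b <= gadd a v)%O) rels.

Definition covers (ps : seq (grade R)) : Prop :=
  forall a, a \in gens -> alive a ->
  has (fun p => region gens rels p && (p <= gadd a v)%O) ps.

Lemma gadd_le2 (g h : grade R) : (g <= h)%O -> (gadd g v <= gadd h v)%O.
Proof.
by move=> /andP[h1 h2]; apply/andP; split; rewrite -num_le /= lerD2r num_le.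
Qed.

Lemma region_gadd_alive (a g : grade R) : (a <= g)%O ->
  region gens rels (gadd g v) -> alive a.
Proof.
move=> ag /andP[_]; apply: contraNN; apply: sub_has => b /le_trans; apply.
exact: gadd_le2.
Qed.

(** Below every degree of the region lies a generator degree, so [v]-generation
    has to be tested on generators only, and a [v]-generating family may be
    replaced by the degrees of its nonzero elements. *)
Lemma shift_dim_covers (K : fieldType) (M : pmod R K) ps :
  thin M (region gens rels) -> covers ps ->
  (forall ps', covers ps' -> (size ps <= size ps')%N) ->
  is_shift_dim M v (size ps).
Proof.
move=> Mthin psP ps_min; have [e [eM eI eE]] := Mthin.
pose mk p : helem M := Tagged (fun g => M g) (e p).
exists (map mk ps); split; last by rewrite size_map.
split.
  apply/(thin_v_generatesP _ _ Mthin) => g /andP[/hasP[a ags ag] _] Igv.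
  have /hasP[p pps /andP[Ip pa]] := psP a ags (region_gadd_alive ag Igv).
  apply/hasP; exists (mk p); first exact: map_f.
  by rewrite /reaches /= eI Ip (le_trans pa)// gadd_le2.
move=> ms /(thin_v_generatesP _ _ Mthin) gen.
rewrite size_map -(size_map (fun m => tag m)); apply: ps_min => a ags aa.
have [Iav|] := boolP (region gens rels (gadd a v)); last first.
  rewrite /region -/(alive a) aa andbT => /hasPn/(_ a ags).
  by rewrite le_gadd.
have [Ia|] := boolP (region gens rels a); last first.
  rewrite /region negb_and negbK => /orP[/hasPn/(_ a ags)|].
    by rewrite lexx.
  move=> rela; case/negP: aa; apply: sub_has rela => b /le_trans; apply.
  exact: le_gadd.
have /hasP[[p m] mms /andP[/= m0 pa]] := gen a Ia Iav.
rewrite has_map; apply/hasP; exists (Tagged (fun g => M g) m) => //=.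
rewrite pa andbT -eI; have [c mE] := eM p m.
by move: m0; rewrite mE scaler_eq0 negb_or => /andP[].
Qed.


(** * The staircase of minimal generators *)

Definition stair : rel (grade R) :=
  fun a b => (a.1%:num <= b.1%:num) && (b.2%:num < a.2%:num).

Lemma gradeE (g h : grade R) :
  (g <= h)%O = (g.1%:num <= h.1%:num) && (g.2%:num <= h.2%:num).
Proof. by rewrite !num_le. Qed.

(** If a generator degree [b] were above an earlier one [a], the basis vectors in
    the other degrees would generate as well, contradicting minimality. *)
Lemma min_generators_stair (K : fieldType) (M : pmod R K)
    (ms : seq (helem M)) :
  thin M (region gens rels) -> lex_sorted gens -> min_generators ms ->
  map (fun m => tag m) ms = gens -> pairwise stair gens.
Proof.
move=> Mthin gens_lex [_ ms_min] ms_tag; have [e [eM eI eE]] := Mthin.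
have sms : size ms = size gens by rewrite -ms_tag size_map.
pose mk p : helem M := Tagged (fun g => M g) (e p).
apply/(pairwiseP (grade0 R)) => i j; rewrite !inE => ilt jlt ij.
set a := nth _ _ i; set b := nth _ _ j.
have ab : ~~ (a <= b)%O.
  apply/negP => ab.
  (* s is gens without b. *)
  pose s := take j gens ++ drop j.+1 gens.
  have smk : (size (map mk s) < size gens)%N.
    by rewrite size_map size_cat size_take jlt size_drop -addSn subnKC.
  have := ms_min (map mk s); rewrite sms leqNgt smk => /(_ _)/notF; apply.
  apply/(thin_generatesP _ Mthin) => g Ig; have /andP[/hasP[c cgens cg] relg] := Ig.
  suff [d ds dg] : exists2 d, d \in s & (d <= g)%O.
    apply/hasP; exists (mk d); first exact: map_f.
    rewrite /reaches dg andbT /= eI; apply/andP; split.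
      apply/hasP; exists d => //; move: ds; rewrite mem_cat.
      by move=> /orP[/mem_take|/mem_drop].
    by apply: contraNN relg; apply: sub_has => r /le_trans; apply.
  move: cgens; rewrite -[X in _ \in X](cat_take_drop j) (drop_nth (grade0 R))//.
  rewrite mem_cat inE orbCA => /orP[/eqP cb|cs]; last first.
    by exists c; rewrite // mem_cat.
  exists a; last by apply: (le_trans ab); rewrite /b -cb.
  rewrite mem_cat /a -(nth_take _ ij) mem_nth// size_take.
  by case: ifP.
have := gens_lex; rewrite /lex_sorted le_sorted_pairwise.
move=> /(pairwiseP (grade0 R))/(_ i j ilt jlt ij); rewrite -/a -/b leEprodlexi.
move=> /andP[ab1 ab2]; rewrite /stair num_le ab1 /= ltNge.
by apply: contraNN ab => ab'; rewrite gradeE num_le ab1.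
Qed.

(** * The greedy cover *)

(** On a staircase, the generators that are not to the right of [a + v] are the
    first [width a] ones. *)
Definition width (a : grade R) : nat :=
  count (fun g : grade R => g.1%:num <= a.1%:num + v.1%:num) gens.

Definition corner (a : grade R) : grade R := nth (grade0 R) gens (width a).-1.

(** Only heights are compared: the corner [p] in use was chosen at a generator to
    the left of [a], hence is not to the right of [a + v]. *)
Definition served (t : option (grade R)) (a : grade R) : bool :=
  if t is Some p then p.2%:num <= a.2%:num + v.2%:num else false.

(** [t] is the corner in use, if any; the result lists the generators at which a
    new corner is taken. *)
Fixpoint greedy (t : option (grade R)) (s : seq (grade R)) : seq (grade R) :=
  if s is a :: s' then
    if alive a && ~~ served t a then a :: greedy (Some (corner a)) s'
    else greedy t s'
  else [::].

Section Stairs.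
Hypothesis gens_stair : pairwise stair gens.

Lemma width_nth a i : (i < size gens)%N ->
  ((nth (grade0 R) gens i).1%:num <= a.1%:num + v.1%:num) = (i < width a)%N.
Proof.
move=> ilt; set r := _ + _; pose xs := [seq g.1%:num | g : grade R <- gens].
have xs_sorted : sorted <=%O xs.
  rewrite le_sorted_pairwise pairwise_map.
  by apply: sub_pairwise gens_stair => g h /andP[].
have widthE : width a = count (<= r) xs by rewrite count_map.
rewrite -(nth_map _ 0 (fun g : grade R => g.1%:num))// widthE.
apply/idP/idP => [|]; last exact: nth_count_le.
apply: contraTT; rewrite -leqNgt -ltNge => le_i.
by apply: nth_count_gt; rewrite // le_i size_map.
Qed.

Lemma width_le a : (width a <= size gens)%N.
Proof. exact: count_size. Qed.

Lemma self_width i : (i < size gens)%N -> (i < width (nth (grade0 R) gens i))%N.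
Proof. by move=> ilt; rewrite -width_nth// lerDl. Qed.

Lemma width_homo a b : a.1%:num <= b.1%:num -> (width a <= width b)%N.
Proof. by move=> ab; apply: sub_count => g /le_trans; apply; rewrite lerD2r. Qed.

Lemma stair_nth i j : (i <= j < size gens)%N ->
  (nth (grade0 R) gens j).2%:num <= (nth (grade0 R) gens i).2%:num.
Proof.
move=> /andP[]; rewrite leq_eqVlt => /orP[/eqP->//|ij] jlt.
have := gens_stair => /(pairwiseP (grade0 R))/(_ i j (ltn_trans ij jlt) jlt ij).
by move=> /andP[_ /ltW].
Qed.

Lemma corner_lowest a g : g \in gens -> g.1%:num <= a.1%:num + v.1%:num ->
  (corner a).2%:num <= g.2%:num.
Proof.
move=> /(nthP (grade0 R))[i ilt <-]; rewrite width_nth// => iw.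
apply: stair_nth; have := width_le a; case: (width a) iw => //= w.
by rewrite ltnS => -> ->.
Qed.

Lemma corner_mem a : a \in gens -> corner a \in gens.
Proof.
move=> /(nthP (grade0 R))[i ilt <-]; apply: mem_nth.
have := self_width ilt; have := width_le (nth (grade0 R) gens i).
by case: width => // w.
Qed.

Lemma corner_le a : a \in gens -> (corner a <= gadd a v)%O.
Proof.
move=> ags; rewrite gradeE /=; apply/andP; split; last first.
  by rewrite (le_trans (corner_lowest ags _)) ?lerDl.
have /(nthP (grade0 R))[i ilt ia] := ags.
have iw : (0 < width a)%N by rewrite -ia (leq_trans _ (self_width ilt)).
by rewrite width_nth ?prednK// (leq_trans _ (width_le a))// prednK.
Qed.

Definition separated : rel (grade R) := fun a b =>
  ~~ has (fun g => (g <= gadd a v)%O && (g <= gadd b v)%O) gens.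

Lemma greedy_subseq t s : subseq (greedy t s) s.
Proof.
elim: s t => //= a s IH t; case: ifP => _; first by rewrite eqxx.
exact: subseq_trans (IH _) (subseq_cons _ _).
Qed.

Lemma greedy_alive t s : all alive (greedy t s).
Proof. by elim: s t => //= a s IH t; case: ifP => //= /andP[-> _]/=. Qed.

(** Once the corner [p] is too high for some generator, it is too high for all the
    later ones, which are lower still. *)
Lemma greedy_below p s : pairwise stair s ->
  all (fun a => a.2%:num + v.2%:num < p.2%:num) (greedy (Some p) s).
Proof.
elim: s => //= a s IH /andP[as_ s_stair]; case: ifP => [/andP[_]|_]; last exact: IH.
rewrite -ltNge => ap /=; rewrite ap /=; apply/allP => b.
move=> /(mem_subseq (greedy_subseq _ _))/(allP as_)/andP[_ ba].
by rewrite (le_lt_trans _ ap)// lerD2r ltW.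
Qed.

(** A generator [g] below [a + v] is not lower than the corner of [a], which in
    turn is higher than [b + v] for every [b] selected after [a]. *)
Lemma greedy_separated t s : pairwise stair s ->
  pairwise separated (greedy t s).
Proof.
elim: s t => //= a s IH t /andP[as_ s_stair]; case: ifP => _ /=; last exact: IH.
rewrite IH// andbT; apply/allP => b /(allP (greedy_below _ s_stair)) bc.
apply/hasPn => g gens_g; rewrite !gradeE /=; apply/negP.
case/andP => /andP[ga _] /andP[_ gb]; move: bc; rewrite ltNge => /negP; apply.
exact: le_trans (corner_lowest gens_g ga) gb.
Qed.

(** Points of a cover that serve different selected generators are different, as
    each of them has a generator below it. *)
Lemma greedy_lower_bound ps : covers ps -> (size (greedy None gens) <= size ps)%N.
Proof.
move=> psP; set cs := greedy None gens.
pose q a p := region gens rels p && (p <= gadd a v)%O.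
(* f a is a point of ps that serves a. *)
pose f a := nth a ps (find (q a) ps).
have fP a : a \in cs -> q a (f a) && (f a \in ps).
  move=> acs; have hq : has (q a) ps.
    apply: psP; first exact: mem_subseq (greedy_subseq _ _) _ acs.
    exact: (allP (greedy_alive _ _)) acs.
  by rewrite nth_find// mem_nth// -has_find.
rewrite -(size_map f cs); apply: uniq_leq_size; last first.
  by move=> _ /mapP[a /fP/andP[_ fa] ->].
rewrite uniq_pairwise pairwise_map.
have := greedy_separated None gens_stair; rewrite -/cs.
apply: (sub_in_pairwise (P := mem cs)); last exact/allP.
move=> a b /fP/andP[/andP[/andP[/hasP[g gens_g ga] _] fa] _].
move=> /fP/andP[/andP[_ fb] _] /hasPn/(_ g gens_g); apply: contraNneq => fab.
by rewrite (le_trans ga fa)/= (le_trans ga)// fab.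
Qed.

(** Holds since the corner of [a] is below [a + v] by its choice, and the
    generators after [a] are further to the right.  The corner [t] in use at the
    start may serve as well, which is what the induction needs. *)
Lemma greedy_serves t s : {subset s <= gens} -> pairwise stair s ->
  (forall p a, t = Some p -> a \in s -> p.1%:num <= a.1%:num + v.1%:num) ->
  {in s, forall a, alive a ->
    has (fun p => (p <= gadd a v)%O)
        (oapp (fun p => [:: p]) [::] t ++ map corner (greedy t s))}.
Proof.
elim: s t => //= a s IH t sgens /andP[as_ s_stair] tP b.
have ags : a \in gens by apply: sgens; rewrite mem_head.
have sgens' : {subset s <= gens} by move=> c cs; apply: sgens; rewrite inE cs orbT.
have ca := corner_le ags.
case: ifP => [_|asv].
  rewrite inE => bs bal; rewrite has_cat /= orbA; apply/orP.
  case/predU1P: bs => [->|bs]; first by left; rewrite ca orbT.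
  have := IH (Some (corner a)) sgens' s_stair _ b bs bal.
  rewrite /= => /(_ _)/orP[p c [<-] cs|->|->]; [|by left; rewrite orbT|by right].
  move: ca; rewrite gradeE => /andP[/le_trans/= + _]; apply.
  by rewrite lerD2r; case/andP: (allP as_ _ cs).
have tP' p c : t = Some p -> c \in s -> p.1%:num <= c.1%:num + v.1%:num.
  by move=> tp cs; apply: tP; rewrite // inE cs orbT.
rewrite inE => /predU1P[->|bs] bal; last exact: IH.
move: asv; rewrite bal /= => /negbFE; case: t tP {tP'} => //= p tP pa.
by rewrite gradeE pa tP// mem_head.
Qed.

Lemma greedy_covers : covers (map corner (greedy None gens)).
Proof.
move=> a ags aal.
have /hasP[p pc pa] :
    has (fun p => (p <= gadd a v)%O) (map corner (greedy None gens)).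
  by rewrite -[map _ _]cat0s; apply: (greedy_serves (t := None)).
apply/hasP; exists p; rewrite // pa andbT; apply/andP; split.
  apply/hasP; exists p => //; move/mapP: pc => [b bc ->]; apply: corner_mem.
  exact: mem_subseq (greedy_subseq _ _) _ bc.
by apply: contraNN aal; apply: sub_has => b /le_trans; apply.
Qed.

Lemma greedy_shift_dim (K : fieldType) (M : pmod R K) :
  thin M (region gens rels) -> is_shift_dim M v (size (greedy None gens)).
Proof.
move=> Mthin; rewrite -(size_map corner); apply: shift_dim_covers => //.
  exact: greedy_covers.
by move=> ps psP; rewrite size_map greedy_lower_bound.
Qed.

End Stairs.
End ShiftDim.

(** * The linear-time program *)

(** Index registers: 0 holds the number of corners taken so far, 1 the generator
    [i] under inspection, 2 the number [l] of generators passed by the second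
    index, 3 the number of generators, 4 the constant zero, and 5 the predecessor
    of [l], which indexes the corner.  Real registers: 0 holds the height of the
    corner in use, 1 and 2 are scratch. *)
Definition greedy_program : program :=
  [:: ILength 3 Gens;
      (* 1: outer loop over i, skipping dead and served generators *)
      IJumpLt 1 3 3;
      RJumpLe 0 0 25;
      JumpZero 1 23;
      IJumpLt 4 0 6;
      RJumpLe 0 0 10;
      RLoad 1 Gens CY 1;
      RShift 2 CY;
      RAdd 1 1 2;
      RJumpLe 0 1 23;
      (* 10: count the i-th generator *)
      ISucc 0;
      RLoad 1 Gens CX 1;
      RShift 2 CX;
      RAdd 1 1 2;
      (* 14: inner loop, advancing l *)
      IJumpLt 2 3 16;
      RJumpLe 0 0 22;
      RLoad 2 Gens CX 2;
      RJumpLe 2 1 19;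
      RJumpLe 0 0 22;
      ICopy 5 2;
      ISucc 2;
      RJumpLe 0 0 14;
      (* 22: load the height of the corner *)
      RLoad 0 Gens CY 5;
      (* 23: next i *)
      ISucc 1;
      RJumpLe 0 0 1].

Section Machine.
Variables (R : realType) (v : grade R) (gens rels : seq (grade R)).
Hypothesis gens_stair : pairwise (@stair R) gens.

Let inp := Input v gens rels.
Let n := size gens.
Let gen i := nth (grade0 R) gens i.
Let wd i := width v gens (gen i).

Definition run : state R -> state R := step inp greedy_program.

(** Some state within [k] steps from [s] satisfies [Q]; a bound rather than an
    exact count, so that the branches of a loop body need not be balanced. *)
Definition leads (k : nat) (s : state R) (Q : state R -> Prop) : Prop :=
  exists2 j, (j <= k)%N & Q (iter j run s).

Lemma leads_refl k s (Q : state R -> Prop) : Q s -> leads k s Q.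
Proof. by exists 0%N. Qed.

Lemma leads_exec k pc f h Q : (pc < 25)%N ->
  leads k (exec inp (nth (IZero 0) greedy_program pc) (State pc f h)) Q ->
  leads k.+1 (State pc f h) Q.
Proof.
move=> pc25 [j jk Qj]; exists j.+1; rewrite // iterSr {2}/run /step.
by rewrite /halted leqNgt pc25.
Qed.

Lemma leads_weaken j k s Q : (j <= k)%N -> leads j s Q -> leads k s Q.
Proof. by move=> jk [i ij Qi]; exists i => //; apply: leq_trans jk. Qed.

Lemma leads_trans j k s (Q Q' : state R -> Prop) :
  leads j s Q -> (forall s', Q s' -> leads k s' Q') -> leads (j + k) s Q'.
Proof.
move=> [i ij Qi] /(_ _ Qi)[i' ik Qi']; exists (i' + i)%N; last by rewrite iterD.
by rewrite addnC leq_add.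
Qed.

(** The contents of the six index registers.  The last one is right for [l = 0]
    too, where truncated subtraction gives its initial value. *)
Definition indices (f : nat -> nat) (d i l : nat) : Prop :=
  map f (iota 0 6) = [:: d; i; l; n; 0%N; l.-1].

(** The second index starts at most at its target [wd i], as it was left at the
    width of an earlier generator; this makes the cost proportional to the
    distance travelled. *)
Lemma inner_loop i d l f h : (i < n)%N ->
  indices f d i l -> (l <= wd i)%N ->
  h 1%N = (gen i).1%:num + v.1%:num ->
  leads (6 * (wd i - l) + 4) (State 14 f h)
    (fun s => pc s = 22%N /\ indices (ireg s) d i (wd i)).
Proof.
move=> iltn; move mE : (wd i - l)%N => m.
elim: m l mE f h => [|m IH] l lm f h reg lw h1.
  have {lw lm}lw : l = wd i by apply/eqP; rewrite eqn_leq lw -subn_eq0 lm.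
  have := reg; case=> f0 f1 f2 f3 f4 f5.
  apply: leads_exec => //=; rewrite f2 f3.
  case: ltnP => [ln|nl]; last first.
    apply: leads_exec => //=; rewrite lexx; apply: leads_refl; split=> //=.
    by rewrite -lw.
  apply: leads_exec => //=; rewrite f2.
  apply: leads_exec => //=; rewrite /upd /= h1.
  rewrite /entry /arr /= width_nth// -/(wd i) -lw ltnn.
  apply: leads_exec => //=; rewrite lexx.
  by apply: leads_refl.
have ll : (l < wd i)%N by rewrite -subn_gt0 lm.
have ln : (l < n)%N := leq_trans ll (width_le _ _ _).
have := reg; case=> f0 f1 f2 f3 f4 f5.
rewrite mulnS -addnA -[(6 + _)%N]/(_.+4.+2).
apply: leads_exec => //=; rewrite f2 f3 ln.
apply: leads_exec => //=; rewrite f2.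
apply: leads_exec => //=; rewrite /upd /= h1.
rewrite /entry /arr /= width_nth// -/(wd i) ll.
apply: leads_exec => //=; apply: leads_exec => //=; apply: leads_exec => //=.
rewrite lexx; apply: (IH l.+1) => //; first by rewrite subnS lm.
by rewrite /indices /= /upd /= f0 f1 f2 f3 f4.
Qed.

Lemma next_index k i d l f h Q : indices f d i l ->
  (forall f', indices f' d i.+1 l -> leads k (State 1 f' h) Q) ->
  leads k.+2 (State 23 f h) Q.
Proof.
move=> [f0 f1 f2 f3 f4 f5] next; do 2!apply: leads_exec => //=.
by rewrite lexx; apply: next; rewrite /indices /= /upd /= f0 f1 f2 f3 f4 f5.
Qed.

Lemma count_generator k i d l f h Q : (i < n)%N -> indices f d i l ->
  (l <= wd i)%N ->
  (forall f' h', indices f' d.+1 i.+1 (wd i) ->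
    h' 0%N = (corner v gens (gen i)).2%:num -> leads k (State 1 f' h') Q) ->
  leads (11 + 6 * (wd i - l) + k) (State 10 f h) Q.
Proof.
move=> iltn [f0 f1 f2 f3 f4 f5] lw next.
rewrite -addnA -[(11 + _)%N]/((7 + _).+4).
do 4!apply: leads_exec => //=.
have -> : (7 + (6 * (wd i - l) + k) = 6 * (wd i - l) + 4 + k.+3)%N.
  by lia.
apply: leads_trans.
  apply: (@inner_loop i d.+1) => //; last by rewrite /upd /= f1.
  by rewrite /indices /= /upd /= f0 f1 f2 f3 f4 f5.
move=> [pc' f' h'] /= [-> reg]; apply: leads_exec => //=.
apply: (next_index reg) => f'' reg'; apply: next => //.
by rewrite /upd /=; case: reg => _ _ _ _ _ ->.
Qed.

(** The cost bound is a potential: 18 per generator not yet inspected by the first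
    index, and 6 per generator not yet passed by the second. *)
Lemma outer_loop t i d l f h : indices f d i l ->
  ((i < n)%N -> (l <= wd i)%N) -> (l <= n)%N ->
  (if t is Some p then (0 < d)%N /\ h 0%N = p.2%:num else d = 0%N) ->
  leads (18 * (n - i) + 6 * (n - l) + 2) (State 1 f h)
    (fun s => pc s = 25%N /\ ireg s 0%N =
      (d + size (greedy v gens rels t (drop i gens)))%N).
Proof.
move mE : (n - i)%N => m; elim: m i mE t d l f h => [|m IH] i im t d l f h reg.
  move=> _ _ _; have ni : (n <= i)%N by rewrite -subn_eq0 im.
  have [f0 f1 f2 f3 f4 f5] := reg; rewrite drop_oversize//= addn2.
  apply: leads_exec => //=; rewrite f1 f3 ltnNge ni.
  apply: leads_exec => //=; rewrite lexx.
  by apply: leads_refl; rewrite /= addn0.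
have iltn : (i < n)%N by rewrite -subn_gt0 im.
have im' : (n - i.+1 = m)%N by rewrite subnS im.
have [f0 f1 f2 f3 f4 f5] := reg.
move=> /(_ iltn) lw ln tP; rewrite (drop_nth (grade0 R))//= -/(gen i).
have wdS : (i.+1 < n)%N -> (wd i <= wd i.+1)%N.
  move=> iltn'; apply: width_homo.
  have := gens_stair => /(pairwiseP (grade0 R))/(_ i i.+1 iltn iltn' (ltnSn i)).
  by case/andP.
pose Q t' d' := fun s : state R => pc s = 25%N /\ ireg s 0%N =
  (d' + size (greedy v gens rels t' (drop i.+1 gens)))%N.
have skip h' : h' 0%N = h 0%N -> forall k, (18 * m + 6 * (n - l) + 4 <= k)%N ->
    leads k (State 23 f h') (Q t d).
  move=> h'0 k /leads_weaken; apply; rewrite !addnS addn0.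
  apply: (next_index reg) => f' reg'; rewrite -addn2; apply: IH => //.
    by move=> iltn'; rewrite (leq_trans lw) ?wdS.
  by rewrite h'0.
have count h' : forall k, (18 * m + 6 * (n - l) + 13 <= k)%N ->
    leads k (State 10 f h') (Q (Some (corner v gens (gen i))) d.+1).
  move=> k /leads_weaken; apply.
  have -> : (18 * m + 6 * (n - l) + 13 =
             11 + 6 * (wd i - l) + (18 * m + 6 * (n - wd i) + 2))%N.
    have -> : (n - l = (wd i - l) + (n - wd i))%N.
      by rewrite addnC addnBA// subnK// width_le.
    by lia.
  apply: (count_generator _ iltn reg lw) => f' h'' reg' h''0; apply: IH => //.
  exact: width_le.
have -> : (18 * m.+1 + 6 * (n - l) + 2 =
           (18 * m + 6 * (n - l) + 13).+4.+3)%N by lia.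
apply: leads_exec => //=; rewrite f1 f3 iltn.
apply: leads_exec => //=; rewrite f1.
have -> : zero_query inp i = ~~ alive v rels (gen i) by rewrite /alive negbK.
have [a_alive|_] := boolP (alive v rels (gen i)); last first.
  by apply: skip => //; lia.
apply: leads_exec => //=; rewrite f0 f4.
case: t tP {skip IH} @Q skip count => [p [d0 h0]|d0] Q skip count /=.
  rewrite d0; do 4!apply: leads_exec => //=.
  rewrite /upd /= h0 /entry /arr /= f1 -/(gen i).
  case: ifP => _; first by apply: skip => //; lia.
  rewrite /= -(addSnnS d); apply: count; lia.
have -> : (0 < d)%N = false by rewrite d0.
apply: leads_exec => //=; rewrite lexx -(addSnnS d).
apply: count; lia.
Qed.

Lemma greedy_program_correct :
  computes_within inp greedy_program (24 * n + 3)
    (size (greedy v gens rels None gens)).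
Proof.
have [j jk [jpc jd]] : leads (24 * n + 3) (init R)
    (fun s => pc s = 25%N /\ ireg s 0%N = size (greedy v gens rels None gens)).
  rewrite addnS; apply: leads_exec => //=.
  apply: (@leads_weaken (18 * (n - 0) + 6 * (n - 0) + 2)); first lia.
  have := @outer_loop None 0 0 0 _ (fun=> 0); rewrite drop0; exact.
rewrite /computes_within -(subnK jk) iterD -/run.
suff -> : iter (24 * n + 3 - j) run (iter j run (init R)) = iter j run (init R).
  by rewrite /halted jpc.
by elim: (_ - j)%N => //= k ->; rewrite /run /step /halted jpc.
Qed.

End Machine.

Theorem corollary3p26 (R : realType) (K : fieldType) :
  exists (p : program) (T : nat -> nat),
    ((fun n : nat => (T n)%:R : R) =O_\oo (fun n : nat => n%:R : R)) /\
    forall (v : grade R) (M : pmod R K) (n : nat) (gens rels : seq (grade R)),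
      0 < v.1%:num -> 0 < v.2%:num ->
      fin_presented M -> is_interval_module M ->
      is_beta0 M n -> given_by M gens rels ->
      exists d : nat,
        is_shift_dim M v d /\ computes_within (Input v gens rels) p (T n) d.
Proof.
exists greedy_program, (fun n => 24 * n + 3)%N; split.
  apply/eqO_exP; exists 27%:R; rewrite ?ltr0n//.
  exists 1%N => // n /= n1.
  rewrite !normr_nat -natrM ler_nat; lia.
move=> v M n gens rels _ _ _ _ [ms [[ms_gen ms_min] <-]] Mgiven.
have Mthin := given_by_thin Mgiven.
have [[gens_lex _] [ms' ms'_min ms'_tag] _ _] := Mgiven.
have gens_stair := min_generators_stair Mthin gens_lex ms'_min ms'_tag.
exists (size (greedy v gens rels None gens)); split.
  exact: greedy_shift_dim.
have -> : size ms = size gens.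
  rewrite -ms'_tag size_map; apply/eqP; rewrite eqn_leq.
  by case: ms'_min => ms'_gen ms'_le; rewrite ms_min// ms'_le.
exact: greedy_program_correct.
Qed.
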